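(* For any monotone XOS function $f$ of width $W$ on a finite ground set $X$, any activation probabilities, and any prefix-closed probing constraint, the adaptivity gap of the stochastic probing problem is $O(\log W)$. Moreover, there are instances with $W=\Theta(n)$ (where $n=|X|$) whose adaptivity gap is $\Omega\big(\frac{\log W}{\log\log W}\big)$.
   Context: A function $f:2^X\to\mathbb{R}_{\ge0}$ is monotone XOS if there are vectors $\mathbf{a}_1,\dots,\mathbf{a}_W\in\mathbb{R}_{\ge0}^X$ with $f(S)=\max_{i}\sum_{e\in S}\mathbf{a}_i(e)$; the width is the smallest such $W$. Stochastic probing problem: each element $e\in X$ is active independently with known probability $p_e$, revealed only upon probing. A probing constraint $\mathcal{F}$ is a family of sequences of distinct elements; it is prefix-closed if every prefix of a sequence in $\mathcal{F}$ is in $\mathcal{F}$. An adaptive strategy is a binary decision tree (nodes labelled by elements, yes/no arcs according to activity, no repeated element on a root-leaf path, every root-leaf sequence in $\mathcal{F}$) receiving $f(A)$ at the leaf, where $A$ is the set of observed active elements. A non-adaptive strategy is a fixed sequence $\sigma\in\mathcal{F}$ with value $\mathbb{E}[f(A\cap\sigma)]$. The adaptivity gap is the ratio of best expected adaptive value to best expected non-adaptive value. *)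

(* Defs.v *)
From HB Require Import structures.
From mathcomp Require Import all_boot all_order all_algebra.
From mathcomp Require Import boolp classical_sets reals ereal.
From mathcomp Require Import topology normedtype sequences exp.
Set Implicit Arguments.
Unset Strict Implicit.
Unset Printing Implicit Defensive.
Import Order.TTheory GRing.Theory Num.Theory.
Local Open Scope ring_scope.

Section XOS.
Variables (R : realType) (X : finType).

(* [f S] is the maximum of the [W] additive values, attained; this forces
   [0 < W]. *)
Definition monotone_xos_with (f : {set X} -> R) (W : nat) : Prop :=
  exists a : 'I_W -> X -> R,
    (forall i e, 0 <= a i e) /\
    (forall S : {set X},
       (forall i, \sum_(e in S) a i e <= f S) /\
       (exists i, f S = \sum_(e in S) a i e)).

Definition monotone_xos_of_width (f : {set X} -> R) (W : nat) : Prop :=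
  monotone_xos_with f W /\
  (forall W' : nat, monotone_xos_with f W' -> (W <= W')%N).

End XOS.

Section Constraint.
Variable X : finType.

Definition probing_constraint (F : set (seq X)) : Prop :=
  forall s, F s -> uniq s.

Definition prefix_closed (F : set (seq X)) : Prop :=
  forall s t, prefix s t -> F t -> F s.

(* In [Probe e y n], the strategy continues with [y] if [e] is active and with
   [n] otherwise; [Stop] is an (unlabelled) leaf. *)
Inductive dtree : Type :=
| Stop
| Probe (e : X) (y n : dtree).

Fixpoint root_leaf_seqs (t : dtree) : seq (seq X) :=
  match t with
  | Stop => [:: [::]]
  | Probe e y n => [seq e :: s | s <- root_leaf_seqs y ++ root_leaf_seqs n]
  end.

Definition adaptive_strategy (F : set (seq X)) (t : dtree) : Prop :=
  forall s, s \in root_leaf_seqs t -> uniq s /\ F s.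

(* The active elements observed when running [t] if [A] is the set of all
   active elements. *)
Fixpoint observed_active (t : dtree) (A : {set X}) : {set X} :=
  match t with
  | Stop => finset.set0
  | Probe e y n =>
      if e \in A then (e |: observed_active y A)%SET
      else observed_active n A
  end.

End Constraint.

Arguments Stop {X}.

Section Probing.
Variables (R : realType) (X : finType).

Definition activation_probabilities (p : X -> R) : Prop :=
  forall e, 0 <= p e <= 1.

(* Probability that the set of active elements is exactly [A]. *)
Definition prob_active (p : X -> R) (A : {set X}) : R :=
  (\prod_(e in A) p e) * (\prod_(e in ~: A) (1 - p e)).

Definition expect_active (p : X -> R) (g : {set X} -> R) : R :=
  \sum_(A : {set X}) prob_active p A * g A.

Definition adaptive_value (p : X -> R) (f : {set X} -> R) (t : dtree X) : R :=
  expect_active p (fun A => f (observed_active t A)).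

Definition nonadaptive_value (p : X -> R) (f : {set X} -> R) (s : seq X) : R :=
  expect_active p (fun A => f (A :&: [set:: s])%SET).

(* These are suprema of bounded sets, since [f] takes finitely many values.
   For an empty [F], which admits no strategy at all, both are 0. *)
Definition best_adaptive (p : X -> R) (f : {set X} -> R)
    (F : set (seq X)) : R :=
  sup [set v | exists2 t, adaptive_strategy F t & v = adaptive_value p f t]%classic.

Definition best_nonadaptive (p : X -> R) (f : {set X} -> R)
    (F : set (seq X)) : R :=
  sup [set v | exists2 s, F s & v = nonadaptive_value p f s]%classic.

(* Division in [\bar R]: a positive numerator over 0 gives +oo, so a finite
   bound [gap <= K], [0 <= K], is always equivalent to
   [best_adaptive <= K * best_nonadaptive]; 0 / 0 is 0. *)
Definition adaptivity_gap (p : X -> R) (f : {set X} -> R)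
    (F : set (seq X)) : \bar R :=
  ((best_adaptive p f F)%:E / (best_nonadaptive p f F)%:E)%E.

End Probing.

(* Main.v *)
(** Upper bound. Let [M] bound every non-adaptive value and call [e] heavy if
    [f {e} > 2M]. On a feasible sequence no heavy element is active with
    probability at least 1/2, so the heavy elements have total mean
    [\sum p_e f {e} <= 2M] on every root-leaf path. For a light element
    [b <= 2M] gives [E exp (b 1_e / 4M) <= exp (2 p_e b / 4M)]; hence, for each of
    the [W] additive functions, [exp ((Z - 2 mu) / 4M)] is a supermartingale
    along the decision tree, where [Z] is the value collected from light
    elements and [mu <= M] its mean along the path followed. A union bound over
    the [W] functions yields [E max Z <= 2M + 4M ln W].

    Lower bound. The elements are the nodes of the [k]-ary tree of depth [k], each
    active with probability [1/k]; [f] is the largest number of selected nodes on a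
    root-leaf path, and a feasible sequence probes only children of nodes of one
    root-leaf path. Descending to an active child whenever there is one
    collects at least [k/2] in expectation, while a fixed root-leaf path collects
    one active node on average, plus at most one node off the path. Here
    [W = k ^ k]. *)

Require Import Defs.
From HB Require Import structures.
From mathcomp Require Import all_boot all_order all_algebra.
From mathcomp Require Import boolp classical_sets reals ereal.
From mathcomp Require Import topology normedtype sequences exp.
From mathcomp Require Import ring lra.
Import Order.TTheory GRing.Theory Num.Theory.
Local Open Scope ring_scope.

(** * Expectations computed step by step along a decision tree *)

Section TreeExpectation.
Import mathcomp.boot.finset.
Set Implicit Arguments.
Unset Strict Implicit.
Variables (R : realType) (X : finType) (p : X -> R).
Implicit Types (t : dtree X) (e : X) (A B : {set X}).

(* Pairs of a probed sequence and the list of its active elements. *)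
Fixpoint outcomes t : seq (seq X * seq X) :=
  match t with
  | Stop => [:: ([::], [::])]
  | Probe e y n => [seq (e :: o.1, e :: o.2) | o <- outcomes y] ++
                   [seq (e :: o.1, o.2) | o <- outcomes n]
  end.

(** A fresh coin is flipped at each probe. The integrand sees both the probed list and the active
    list, so that compensators may depend on the path followed. *)
Fixpoint tree_exp t (g : seq X -> seq X -> R) : R :=
  match t with
  | Stop => g [::] [::]
  | Probe e y n => p e * tree_exp y (fun s a => g (e :: s) (e :: a)) +
                   (1 - p e) * tree_exp n (fun s a => g (e :: s) a)
  end.

Lemma outcomes_path t o : o \in outcomes t -> o.1 \in root_leaf_seqs t.
Proof.
elim: t o => [|e y IHy n IHn] o /=; first by rewrite inE => /eqP->.
rewrite mem_cat => /orP[] /mapP[o' o'P ->] /=; apply: map_f; rewrite mem_cat.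
  by rewrite IHy.
by rewrite orbC IHn.
Qed.

Lemma root_leaf_outcome t s :
  s \in root_leaf_seqs t -> exists2 o, o \in outcomes t & o.1 = s.
Proof.
elim: t s => [|e y IHy n IHn] s /=.
  by rewrite inE => /eqP->; exists ([::], [::]); rewrite ?inE.
case/mapP => s'; rewrite mem_cat => /orP[/IHy|/IHn] [o oI <-] ->.
  by exists (e :: o.1, e :: o.2) => //; rewrite mem_cat; apply/orP; left; apply/mapP; exists o.
by exists (e :: o.1, o.2) => //; rewrite mem_cat; apply/orP; right; apply/mapP; exists o.
Qed.

Lemma outcomes_subseq t o : o \in outcomes t -> subseq o.2 o.1.
Proof.
elim: t o => [|e y IHy n IHn] o /=; first by rewrite inE => /eqP->.
rewrite mem_cat => /orP[] /mapP[o' o'P ->] /=.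
  by rewrite eqxx IHy.
exact: subseq_trans (IHn _ o'P) (subseq_cons _ _).
Qed.

Lemma eq_tree_exp t g h :
  (forall o, o \in outcomes t -> g o.1 o.2 = h o.1 o.2) ->
  tree_exp t g = tree_exp t h.
Proof.
elim: t g h => [|e y IHy n IHn] g h /= gh; first exact: (gh ([::], [::]) (mem_head _ _)).
congr (_ * _ + _ * _).
- apply: IHy => o oy; apply: (gh (e :: o.1, e :: o.2)).
  by rewrite mem_cat; apply/orP; left; apply/mapP; exists o.
- apply: IHn => o oy; apply: (gh (e :: o.1, o.2)).
  by rewrite mem_cat; apply/orP; right; apply/mapP; exists o.
Qed.

Lemma tree_expD t g h :
  tree_exp t (fun s a => g s a + h s a) = tree_exp t g + tree_exp t h.
Proof. by elim: t g h => [|e y IHy n IHn] g h //=; rewrite IHy IHn; ring. Qed.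

Lemma tree_expZ t c g : tree_exp t (fun s a => c * g s a) = c * tree_exp t g.
Proof. by elim: t g => [|e y IHy n IHn] g //=; rewrite IHy IHn; ring. Qed.

Lemma tree_exp_cst t c : tree_exp t (fun _ _ => c) = c.
Proof. by elim: t => [|e y IHy n IHn] //=; rewrite IHy IHn; ring. Qed.

Lemma tree_exp_sum t (I : finType) (G : I -> seq X -> seq X -> R) :
  tree_exp t (fun s a => \sum_i G i s a) = \sum_i tree_exp t (G i).
Proof.
elim: t G => [|e y IHy n IHn] G //=.
by rewrite IHy IHn big_split /= -!mulr_sumr.
Qed.

(** Wald-type identity: whether [e] is probed is decided before its coin is flipped, so each probe
    of [e] contributes [p e * v e] on average. *)
Lemma tree_exp_active_sum t (v : X -> R) :
  tree_exp t (fun _ a => \sum_(e <- a) v e) =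
  tree_exp t (fun s _ => \sum_(e <- s) p e * v e).
Proof.
elim: t => [|e y IHy n IHn] /=; first by rewrite !big_nil.
rewrite (@eq_tree_exp y _ (fun _ a => v e + \sum_(j <- a) v j)); last first.
  by move=> o _; rewrite big_cons.
rewrite (@eq_tree_exp y (fun s _ => \sum_(j <- e :: s) p j * v j)
  (fun s _ => p e * v e + \sum_(j <- s) p j * v j)); last first.
  by move=> o _; rewrite big_cons.
rewrite (@eq_tree_exp n (fun s _ => \sum_(j <- e :: s) p j * v j)
  (fun s _ => p e * v e + \sum_(j <- s) p j * v j)); last first.
  by move=> o _; rewrite big_cons.
by rewrite !tree_expD !tree_exp_cst IHy IHn; ring.
Qed.

(** The sets [B] and [e |: B] are paired; their probabilities share the factor coming from the
    elements other than [e]. *)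
Lemma expect_split e (h : {set X} -> R) :
  expect_active p h =
  \sum_(B : {set X} | e \notin B)
    (\prod_(j in B) p j * \prod_(j in (~: B) :\ e) (1 - p j))%SET *
      (p e * h (e |: B)%SET + (1 - p e) * h B).
Proof.
rewrite /expect_active (bigID (fun A : {set X} => e \in A)) /=.
rewrite (reindex_onto (fun B : {set X} => (e |: B)%SET)
                      (fun A : {set X} => (A :\ e)%SET)) /=; last first.
  by move=> A eA; rewrite setD1K.
rewrite (eq_bigl (fun B : {set X} => e \notin B)); last first.
  move=> B; rewrite setU11 /=; apply/eqP/idP => [<-|eB]; first by rewrite !inE eqxx.
  by rewrite setU1K.
rewrite -big_split /=; apply: eq_bigr => B eB.
rewrite /prob_active big_setU1 //=.
have -> : (~: (e |: B) = (~: B) :\ e)%SET.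
  by apply/setP => j; rewrite !inE negb_or.
by rewrite (big_setD1 e (A := (~: B)%SET)) /= ?in_setC //; ring.
Qed.

(** Conditioning on the status of [e]. On the right the integrands no longer depend on that status,
    so the conditional laws can be replaced by the full product law. *)
Lemma expect_active_cond e (h : {set X} -> R) :
  expect_active p h =
  p e * expect_active p (fun A => h (e |: A)%SET) +
  (1 - p e) * expect_active p (fun A => h (A :\ e)%SET).
Proof.
rewrite !(expect_split e) !mulr_sumr -big_split /=; apply: eq_bigr => B eB.
have -> : (e |: (e |: B) = e |: B)%SET by rewrite setUA setUid.
have -> : ((e |: B) :\ e = B)%SET by rewrite setU1K.
have -> : (B :\ e = B)%SET.
  by apply/setP => j; rewrite !inE; case: eqP => // ->; rewrite (negPf eB).
by ring.
Qed.

Lemma expect_active_cst c : expect_active p (fun _ => c) = c.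
Proof.
rewrite /expect_active -mulr_suml [X in X * _](_ : _ = 1) ?mul1r //.
transitivity (\prod_(e : X) (p e + (1 - p e))); last first.
  by rewrite big1 // => e _; ring.
rewrite bigA_distr; apply: eq_bigr => A _.
rewrite (bigID (fun e => e \in A)) /=; congr (_ * _).
  by apply: eq_bigr => e ->.
by apply: eq_big => e; rewrite ?in_setC // => /negbTE ->.
Qed.

Definition read_once t := forall s, s \in root_leaf_seqs t -> uniq s.

Lemma read_once_probe e y n : read_once (Probe e y n) ->
  [/\ read_once y, read_once n,
      forall s, s \in root_leaf_seqs y -> e \notin s &
      forall s, s \in root_leaf_seqs n -> e \notin s].
Proof.
move=> ro.
have H s : s \in root_leaf_seqs y ++ root_leaf_seqs n -> (e \notin s) && uniq s.
  by move=> sI; apply: (ro (e :: s)); apply: map_f.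
by split=> s sI; move: (H s); rewrite mem_cat sI ?orbT => /(_ isT)/andP[].
Qed.

Lemma root_leaf_seqs_neq0 t : exists s, s \in root_leaf_seqs t.
Proof.
elim: t => [|e y [s sy] n _] /=; first by exists [::]; rewrite inE.
by exists (e :: s); apply: map_f; rewrite mem_cat sy.
Qed.

Lemma observed_active_local t e A B :
  (forall s, s \in root_leaf_seqs t -> e \notin s) ->
  (A :\ e = B :\ e)%SET -> observed_active t A = observed_active t B.
Proof.
elim: t => [|j y IHy n IHn] //= et AB.
have Hy s : s \in root_leaf_seqs y -> e \notin s.
  move=> sI; have := et (j :: s) (map_f _ _).
  by rewrite mem_cat sI inE negb_or => /(_ isT)/andP[].
have Hn s : s \in root_leaf_seqs n -> e \notin s.
  move=> sI; have := et (j :: s) (map_f _ _).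
  by rewrite mem_cat sI orbT inE negb_or => /(_ isT)/andP[].
have je : j != e.
  have [s sy] := root_leaf_seqs_neq0 y; have := et (j :: s) (map_f _ _).
  by rewrite mem_cat sy inE negb_or eq_sym => /(_ isT)/andP[].
move/setP/(_ j): (AB); rewrite !in_setD1 je /= => ->.
by rewrite IHy // IHn.
Qed.

(** Drawing all statuses in advance agrees with flipping a coin at each probe: after conditioning on
    the root [e], the subtrees never look at [e] again, so adding or removing it is invisible to
    them. *)
Lemma expect_observed t (h : {set X} -> R) : read_once t ->
  expect_active p (fun A => h (observed_active t A)) =
  tree_exp t (fun _ a => h [set:: a]%SET).
Proof.
elim: t h => [|e y IHy n IHn] h /=; first by rewrite expect_active_cst set_nil.
case/read_once_probe => roy ron ey en; rewrite (expect_active_cond e).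
under [in X in X + _]eq_fun do rewrite setU11.
under [in X in _ + X]eq_fun do rewrite setD11.
congr (_ * _ + _ * _).
- rewrite (@eq_tree_exp y _ (fun _ a => h (e |: [set:: a])%SET)); last first.
    by move=> o _; rewrite set_cons.
  rewrite -(IHy (fun S => h (e |: S)%SET)) //.
  congr (expect_active p _); apply/funext => A.
  congr (h (_ |: _)%SET); apply: observed_active_local ey _.
  by apply/setP => j; rewrite !inE; case: eqP.
- rewrite -IHn //; congr (expect_active p _); apply/funext => A.
  congr h; apply: observed_active_local en _.
  by apply/setP => j; rewrite !inE; case: eqP.
Qed.

(** A fixed sequence seen as a tree with equal branches, so that tree expectations also cover
    non-adaptive values. *)
Definition chain (s : seq X) : dtree X :=
  foldr (fun e t => Probe e t t) Stop s.

Lemma observed_chain s A : observed_active (chain s) A = (A :&: [set:: s])%SET.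
Proof.
elim: s => [|e s IHs] /=; first by rewrite set_nil setI0.
rewrite IHs set_cons; apply/setP => j.
by case: ifP => eA; rewrite !inE; case: eqP => [->|]; rewrite ?eA ?andbF.
Qed.

Lemma chain_path s s' : s' \in root_leaf_seqs (chain s) -> s' = s.
Proof.
elim: s s' => [|e s IHs] s' /=; first by rewrite inE => /eqP.
by case/mapP => s1; rewrite mem_cat orbb => /IHs -> ->.
Qed.

Lemma nonadaptive_chain s (f : {set X} -> R) : uniq s ->
  nonadaptive_value p f s = tree_exp (chain s) (fun _ a => f [set:: a]%SET).
Proof.
move=> us; rewrite -expect_observed; last by move=> s' /chain_path ->.
by rewrite /nonadaptive_value; under eq_fun do rewrite -observed_chain.
Qed.

Hypothesis p01 : activation_probabilities p.

Lemma le_tree_exp t g h :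
  (forall o, o \in outcomes t -> g o.1 o.2 <= h o.1 o.2) ->
  tree_exp t g <= tree_exp t h.
Proof.
elim: t g h => [|e y IHy n IHn] g h /= gh; first exact: (gh ([::], [::]) (mem_head _ _)).
have /andP[p0 p1] := p01 e; apply: lerD; apply: ler_wpM2l => //.
- apply: IHy => o oy; apply: (gh (e :: o.1, e :: o.2)).
  by rewrite mem_cat; apply/orP; left; apply/mapP; exists o.
- by rewrite subr_ge0.
- apply: IHn => o oy; apply: (gh (e :: o.1, o.2)).
  by rewrite mem_cat; apply/orP; right; apply/mapP; exists o.
Qed.

(* One step multiplies the conditional expectation by
   [(p e * expR (b e) + 1 - p e) * expR (- c e) <= 1], whatever is probed. *)
Lemma tree_exp_supermartingale t (b c : X -> R) :
  (forall e, p e * (expR (b e) - 1) <= c e) ->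
  tree_exp t (fun s a => expR (\sum_(e <- a) b e - \sum_(e <- s) c e)) <= 1.
Proof.
move=> bc; elim: t => [|e y IHy n IHn] /=; first by rewrite !big_nil subr0 expR0.
rewrite (@eq_tree_exp y _ (fun s a => expR (b e - c e) *
  expR (\sum_(j <- a) b j - \sum_(j <- s) c j))); last first.
  by move=> o _; rewrite !big_cons -expRD; congr expR; ring.
rewrite (@eq_tree_exp n _ (fun s a => expR (- c e) *
  expR (\sum_(j <- a) b j - \sum_(j <- s) c j))); last first.
  by move=> o _; rewrite !big_cons -expRD; congr expR; ring.
rewrite !tree_expZ expRD; have /andP[p0 p1] := p01 e.
have c0 := expR_gt0 (- c e); have b0 := expR_gt0 (b e).
set Y := tree_exp y _ in IHy *; set N := tree_exp n _ in IHn *.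
apply: (@le_trans _ _ (expR (- c e) * (1 + p e * (expR (b e) - 1)))).
  rewrite (_ : _ + _ = expR (- c e) * (p e * expR (b e) * Y + (1 - p e) * N));
    last by ring.
  apply: ler_wpM2l; first exact: ltW.
  have H1 : p e * expR (b e) * Y <= p e * expR (b e) * 1.
    by apply: ler_wpM2l => //; rewrite mulr_ge0 // ltW.
  have H2 : (1 - p e) * N <= (1 - p e) * 1 by apply: ler_wpM2l => //; rewrite subr_ge0.
  by lra.
(* It remains to see that [1 + p e * (expR (b e) - 1) <= expR (c e)], which goes through [expR] of
   the increment bounded by [c e]. *)
rewrite -[leRHS](expRxMexpNx_1 (c e)) mulrC; apply: ler_wpM2r; first exact: ltW.
apply: le_trans (expR_ge1Dx _) _; rewrite ler_expR; exact: bc.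
Qed.

End TreeExpectation.

(** * Strategy values against their suprema *)

Section BestValues.
Import mathcomp.boot.finset.
Set Implicit Arguments.
Unset Strict Implicit.
Variables (R : realType) (X : finType) (f : {set X} -> R) (p : X -> R).
Variable (F : classical_sets.set (seq X)).
Hypothesis p01 : activation_probabilities p.
Hypothesis f_mono : forall S T : {set X}, S \subset T -> f S <= f T.

Lemma expect_active_le (g h : {set X} -> R) :
  (forall A, g A <= h A) -> expect_active p g <= expect_active p h.
Proof.
move=> gh; apply: ler_sum => A _; apply: ler_wpM2l => //.
by rewrite mulr_ge0 // prodr_ge0 // => e _; have /andP[] := p01 e; rewrite ?subr_ge0.
Qed.

(** Supplies the upper bound under which [sup] is a genuine least upper bound. *)
Lemma expect_active_leT (g : {set X} -> {set X}) :
  expect_active p (fun A => f (g A)) <= f [set: X].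
Proof.
rewrite -[leRHS](expect_active_cst p); apply: expect_active_le => A.
exact/f_mono/subsetT.
Qed.

Lemma adaptive_le_best t :
  adaptive_strategy F t -> adaptive_value p f t <= best_adaptive p f F.
Proof.
move=> tF; apply: ub_le_sup; last by exists t.
by exists (f [set: X]) => _ [t' _ ->]; exact: expect_active_leT.
Qed.

Lemma nonadaptive_le_best s :
  F s -> nonadaptive_value p f s <= best_nonadaptive p f F.
Proof.
move=> sF; apply: ub_le_sup; last by exists s.
by exists (f [set: X]) => _ [s' _ ->]; exact: expect_active_leT.
Qed.

End BestValues.

(** * The logarithmic upper bound on the gap *)

Section UpperBound.
Import mathcomp.boot.finset.
Set Implicit Arguments.
Unset Strict Implicit.
Variables (R : realType) (X : finType) (f : {set X} -> R) (W : nat) (p : X -> R).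
Variable (F : classical_sets.set (seq X)).

(** From [1 - x <= expR (- x)] one gets [expR x * (1 - x) <= 1], and [1 <= (1 + 2 * x) * (1 - x)] on
    this interval. *)
Lemma expR_le1D2x (x : R) : 0 <= x <= 2^-1 -> expR x <= 1 + 2 * x.
Proof.
move=> /andP[x0 x1]; have := expRxMexpNx_1 x; have := expR_ge1Dx (- x).
have := expR_gt0 x; move: (expR x) (expR (- x)) => u v u0 hv uv.
have x2 : 0 < 1 - x by lra.
rewrite -(ler_pM2r x2); apply: (@le_trans _ _ 1); last by nra.
by rewrite -uv; apply: ler_wpM2l; [exact: ltW | lra].
Qed.

Lemma ln2_ge : 2^-1 <= ln (2 : R).
Proof.
rewrite -[leLHS]expRK ler_ln ?posrE ?expR_gt0 //.
by apply: le_trans (expR_le1D2x _) _; lra.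
Qed.

Hypothesis p01 : activation_probabilities p.
Hypothesis xosf : monotone_xos_with f W.

Lemma xos_ge0 S : 0 <= f S.
Proof.
case: xosf => a [a0 /(_ S)[_ [i ->]]]; exact: sumr_ge0.
Qed.

Lemma xos_mono (S T : {set X}) : S \subset T -> f S <= f T.
Proof.
case: xosf => a [a0 fa] ST; have [_ [i ->]] := fa S; have [+ _] := fa T.
move=> /(_ i); apply: le_trans; rewrite [leRHS](big_setID S) /=.
by rewrite (setIidPr ST) lerDl sumr_ge0.
Qed.

Lemma sum_set_seq (v : X -> R) (s : seq X) : uniq s ->
  \sum_(e in [set:: s]) v e = \sum_(e <- s) v e.
Proof. by move=> us; rewrite big_uniq //; apply: eq_bigl => e; rewrite in_set. Qed.

(* [D] is the probability that no heavy element of [s] is active. *)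
Lemma chain_heavy (m : R) (s : seq X) : 0 <= m ->
  let heavy e := m < f [set e] in
  let D := \prod_(e <- s | heavy e) (1 - p e) in
  let V := tree_exp p (chain s) (fun _ a => f [set:: a]) in
  [/\ 0 <= D <= 1, m * (1 - D) <= V &
      D * (\sum_(e <- s | heavy e) p e * f [set e]) <= V].
Proof.
move=> m0 /=; elim: s => [|e s [/andP[D0 D1] IH1 IH2]] /=.
  by rewrite !big_nil subrr mulr0 mul1r ler01 lexx xos_ge0.
rewrite !big_cons; have /andP[p0 p1] := p01 e.
set V := tree_exp p (chain s) _ in IH1 IH2 *.
set D := \prod_(_ <- _ | _) _ in D0 D1 IH1 IH2 *.
set G := \sum_(_ <- _ | _) _ in IH2 *.
(* [V1] is the value once [e] is known to be active; it dominates both [V] and [f [set e]], and the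
   new value is [p e * V1 + (1 - p e) * V]. *)
set V1 := tree_exp p (chain s) _.
have G0 : 0 <= G.
  by apply: sumr_ge0 => j _; rewrite mulr_ge0 ?xos_ge0 //; case/andP: (p01 j).
have q0 : 0 <= 1 - p e by rewrite subr_ge0.
have VV1 : V <= V1.
  by apply: le_tree_exp => // o _; apply: xos_mono; rewrite set_cons subsetUr.
have eV1 : f [set e] <= V1.
  rewrite -[leLHS](tree_exp_cst p (chain s)); apply: le_tree_exp => // o _.
  by apply: xos_mono; rewrite set_cons subsetUl.
have VV : V <= p e * V1 + (1 - p e) * V.
  have : p e * V <= p e * V1 by exact: ler_wpM2l.
  by lra.
case: ifP => he; last by split; [rewrite D0 D1 | exact: le_trans VV | exact: le_trans VV].
(* Heavy head: in both inequalities the active branch pays for the new term of [e], and the inactive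
   branch for the induction hypothesis scaled by [1 - p e]. *)
have pv : p e * f [set e] <= p e * V1 by exact: ler_wpM2l.
have pm : p e * m <= p e * f [set e] by apply: ler_wpM2l => //; exact: ltW.
split.
- rewrite mulr_ge0 //=; apply: (@le_trans _ _ (1 * 1)); last by rewrite mulr1.
  by apply: ler_pM => //; lra.
- have : (1 - p e) * (m * (1 - D)) <= (1 - p e) * V by exact: ler_wpM2l.
  by lra.
- have : (1 - p e) * (D * G) <= (1 - p e) * V by exact: ler_wpM2l.
  have : (1 - p e) * D * (p e * f [set e]) <= 1 * (p e * f [set e]).
    apply: ler_wpM2r; first by rewrite mulr_ge0 ?xos_ge0.
    rewrite -[leRHS]mulr1; apply: ler_pM => //; lra.
  by rewrite mul1r; lra.
Qed.

(** With threshold [2 * M], the bound [2 * M * (1 - D) <= M] forces [D >= 1/2], and then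
    [D * G <= M] gives [G <= 2 * M]. *)
Lemma heavy_sum_le (M : R) (s : seq X) : 0 < M -> uniq s ->
  nonadaptive_value p f s <= M ->
  \sum_(e <- s | 2 * M < f [set e]) p e * f [set e] <= 2 * M.
Proof.
move=> M0 us; rewrite nonadaptive_chain //.
have m0 : 0 <= 2 * M by lra.
have [/=] := chain_heavy s m0.
set D := \prod_(_ <- _ | _) _; set G := \sum_(_ <- _ | _) _; set V := tree_exp _ _ _.
move=> /andP[D0 D1] H1 H2 VM.
have G0 : 0 <= G.
  by apply: sumr_ge0 => j _; rewrite mulr_ge0 ?xos_ge0 //; case/andP: (p01 j).
have D2 : 2^-1 <= D.
  rewrite -(ler_pM2l (_ : 0 < 2 * M)); last by lra.
  by lra.
have : 2^-1 * G <= D * G by exact: ler_wpM2r.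
by lra.
Qed.

Lemma mean_le_nonadaptive (b : X -> R) (s : seq X) : uniq s ->
  (forall S : {set X}, \sum_(e in S) b e <= f S) ->
  \sum_(e <- s) p e * b e <= nonadaptive_value p f s.
Proof.
move=> us bf; rewrite nonadaptive_chain //.
rewrite -[leLHS](tree_exp_cst p (chain s)).
rewrite (@eq_tree_exp _ _ _ (chain s) _ (fun s _ => \sum_(e <- s) p e * b e)); last first.
  by move=> o /outcomes_path /chain_path ->.
rewrite -tree_exp_active_sum; apply: le_tree_exp => // o oI.
rewrite -sum_set_seq //; apply: subseq_uniq (outcomes_subseq oI) _.
by rewrite (chain_path (outcomes_path oI)).
Qed.

Lemma adaptive_value_le (M : R) (t : dtree X) : 0 < M -> read_once t ->
  (forall s, s \in root_leaf_seqs t -> nonadaptive_value p f s <= M) ->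
  adaptive_value p f t <= 4 * M * (1 + ln W%:R).
Proof.
move=> M0 rot naM; case: (xosf) => a [a0 fa].
have W0 : (0 < W)%N by case: (fa set0) => _ [[i iW] _]; exact: leq_ltn_trans iW.
have WR0 : 0 < W%:R :> R by rewrite ltr0n.
pose light e := f [set e] <= 2 * M.
pose b i e := if light e then a i e else 0.
(* A heavy element is charged its full singleton value, whatever the index [i]; only the light part
   then needs control uniform in [i]. *)
pose v e := if light e then 0 else f [set e].
have af i e : a i e <= f [set e].
  by have [/(_ i)+ _] := fa [set e]; rewrite big_set1.
have b0 i e : 0 <= b i e by rewrite /b; case: ifP.
have ba i e : b i e <= a i e by rewrite /b; case: ifP.
(* This scale makes [th * b i e <= 1/2], the range of [expR_le1D2x], whose factor 2 reappears in the
   compensator of [G]. *)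
pose th := (4 * M)^-1; have th0 : 0 < th by rewrite invr_gt0; lra.
have thM : 4 * M * th = 1 by rewrite /th mulfV //; lra.
pose G i s (act : seq X) :=
  expR (\sum_(e <- act) th * b i e - \sum_(e <- s) 2 * p e * (th * b i e)).
have EG i : tree_exp p t (G i) <= 1.
  apply: tree_exp_supermartingale => // e; have /andP[p0 p1] := p01 e.
  rewrite -mulrA mulrCA; apply: ler_wpM2l => //.
  suff : expR (th * b i e) <= 1 + 2 * (th * b i e) by lra.
  apply: expR_le1D2x; rewrite mulr_ge0 ?(ltW th0) //=.
  have bM : b i e <= 2 * M.
    by rewrite /b; case: ifP => [/(le_trans (af i e))//|_]; lra.
  have : th * b i e <= th * (2 * M) by apply: ler_wpM2l => //; exact: ltW.
  by lra.
rewrite /adaptive_value expect_observed //.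
(* [H] is a pointwise majorant of [f]: the sum of all [G i] replaces the maximum over [i], [2 * M]
   bounds twice the light mean, and the rest of [c0] comes from the tangent line below. In
   expectation the [G] term adds [4 * M] and the heavy term [2 * M]. *)
pose c0 := 2 * M + 4 * M * (ln W%:R - 1).
pose H s act := c0 + 4 * M * W%:R^-1 * (\sum_i G i s act)
  + \sum_(e <- act) v e.
apply: (@le_trans _ _ (tree_exp p t H)).
  apply: le_tree_exp => // o oI.
  have us := rot _ (outcomes_path oI).
  have ua := subseq_uniq (outcomes_subseq oI) us.
  have [_ [i ->]] := fa [set:: o.2]; rewrite sum_set_seq //.
  have Hv : \sum_(e <- o.2) a i e <= \sum_(e <- o.2) b i e + \sum_(e <- o.2) v e.
    rewrite -big_split /=; apply: ler_sum => e _; rewrite /b /v.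
    by case: ifP => _; rewrite ?addr0 ?add0r.
  have Hmu : \sum_(e <- o.1) p e * b i e <= M.
    apply: le_trans (naM _ (outcomes_path oI)); apply: mean_le_nonadaptive => // S.
    by have [/(_ i)+ _] := fa S; apply: le_trans; apply: ler_sum.
  set Z := \sum_(e <- o.2) b i e in Hv *; set mu := \sum_(e <- o.1) _ in Hmu.
  have Gi : G i o.1 o.2 = expR (th * Z - 2 * th * mu).
    congr expR; rewrite -mulr_sumr; congr (_ - _); rewrite mulr_sumr.
    by apply: eq_bigr => e _; ring.
  have sG : G i o.1 o.2 <= \sum_j G j o.1 o.2.
    by rewrite (bigD1 i) //= lerDl sumr_ge0 // => j _; exact: expR_ge0.
  (* tangent line of the exponential at [ln W] *)
  have := expR_ge1Dx (th * Z - 2 * th * mu - ln W%:R).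
  rewrite expRD expRN lnK ?posrE // -Gi => tang.
  have tang2 : 1 + (th * Z - 2 * th * mu - ln W%:R) <= W%:R^-1 * \sum_j G j o.1 o.2.
    apply: le_trans tang _; by rewrite mulrC; apply: ler_wpM2l.
  have M4 : 0 <= 4 * M by lra.
  have := ler_wpM2l M4 tang2; rewrite /H /c0.
  have -> : 4 * M * (1 + (th * Z - 2 * th * mu - ln W%:R)) =
     4 * M + (4 * M * th) * Z - 2 * (4 * M * th) * mu - 4 * M * ln W%:R by ring.
  rewrite thM mulrA.
  by lra.
have -> : tree_exp p t H = c0 + 4 * M * W%:R^-1 * (\sum_i tree_exp p t (G i)) +
    tree_exp p t (fun s _ => \sum_(e <- s) p e * v e).
  rewrite -tree_exp_active_sum -tree_exp_sum -tree_expZ.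
  by rewrite -[c0 in RHS](tree_exp_cst p t) -!tree_expD.
rewrite /c0.
have HG : 4 * M * W%:R^-1 * \sum_i tree_exp p t (G i) <= 4 * M.
  rewrite -[leRHS](divfK (lt0r_neq0 WR0)); apply: ler_wpM2l.
    by rewrite mulr_ge0 ?invr_ge0 ?(ltW WR0) //; lra.
  apply: le_trans (ler_sum _ (fun i _ => EG i)) _.
  by rewrite sumr_const card_ord.
have Hv : tree_exp p t (fun s _ => \sum_(e <- s) p e * v e) <= 2 * M.
  rewrite -[leRHS](tree_exp_cst p t); apply: le_tree_exp => // o oI.
  have := heavy_sum_le M0 (rot _ (outcomes_path oI)) (naM _ (outcomes_path oI)).
  apply: le_trans; rewrite [leRHS]big_mkcond /=; apply: ler_sum => e _.
  by rewrite /v /light; case: leP => _; rewrite ?mulr0.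
by lra.
Qed.

Lemma adaptivity_gap_le : probing_constraint F ->
  (adaptivity_gap p f F <= (12 * ln (maxn W 2)%:R)%:E)%E.
Proof.
move=> uF; rewrite /adaptivity_gap.
set NA := best_nonadaptive p f F; set AD := best_adaptive p f F.
have NAub s : F s -> nonadaptive_value p f s <= NA.
  exact: (nonadaptive_le_best p01 xos_mono).
have NA0 : 0 <= NA.
  rewrite /NA /best_nonadaptive; case: (pselect (exists s, F s)) => [[s Fs]|nF].
    apply: le_trans (NAub _ Fs); rewrite -[leLHS](expect_active_cst p).
    by apply: (expect_active_le p01) => A; exact: xos_ge0.
  by rewrite sup_out // => -[[_ [s Fs _]] _]; apply: nF; exists s.
(* Since the logarithm [L] of [maxn W 2] is at least 1/2, [4 * (1 + ln W) <= 4 * (2 * L + L)],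
   whence the constant 12. *)
have ln2 := ln2_ge.
have l2 : ln (2 : R) <= ln (maxn W 2)%:R.
  by rewrite ler_ln ?posrE ?ltr0n ?leq_max ?orbT // ler_nat leq_maxr.
have lW : ln W%:R <= ln (maxn W 2)%:R :> R.
  have [Weq|Wgt] := posnP W; first by rewrite {1}Weq ln0 //; lra.
  by rewrite ler_ln ?posrE ?ltr0n ?leq_max ?Wgt //= ler_nat leq_maxl.
set L := ln (maxn W 2)%:R in l2 lW *.
(* Stated for every positive [M] above [NA], so that it remains usable when [NA = 0]. *)
have ADle M : 0 < M -> NA <= M -> AD <= 12 * L * M.
  move=> M0 NM; rewrite /AD /best_adaptive.
  set E := [set v | _]%classic; case: (pselect (E !=set0)%classic) => [E0|nE]; last first.
    by rewrite sup_out => [|[]//]; rewrite mulr_ge0 //; lra.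
  apply: ge_sup => // _ [t tF ->].
  apply: le_trans (@adaptive_value_le M t M0 _ _) _.
  - by move=> s /tF[].
  - by move=> s /tF[_ /NAub sNA]; exact: le_trans NM.
  - have : M * (4 * (1 + ln W%:R)) <= M * (12 * L).
      by apply: ler_wpM2l; [exact: ltW | lra].
    by lra.
have [NAeq|NAneq] := eqVneq NA 0; last first.
  have NAp : 0 < NA by rewrite lt_neqAle eq_sym NAneq.
  by rewrite inver (negbTE NAneq) lee_pdivrMr // lee_fin ADle.
have AD0 : AD <= 0.
  have [//|ADp] := leP AD 0.
  (* The choice [M = AD / (24 * L)] would give [AD <= AD / 2]. *)
  have K0 : 0 < 24 * L by lra.
  have := ADle (AD / (24 * L)) (divr_gt0 ADp K0).
  rewrite NAeq => /(_ (ltW (divr_gt0 ADp K0))).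
  have -> : 12 * L * (AD / (24 * L)) = AD / 2 by field; lra.
  by lra.
rewrite NAeq inve0; have [->|ADn] := eqVneq AD 0.
  by rewrite mul0e lee_fin; lra.
by rewrite lt0_muley ?leNye // lte_fin lt_neqAle ADn.
Qed.

End UpperBound.

(** * Instances with a large gap on the [k]-ary tree *)

Section LowerBound.
Import mathcomp.boot.finset.
Set Implicit Arguments.
Unset Strict Implicit.
Variables (R : realType) (N : nat).
(* [4 <= k] gives [1 <= ln k], so that [ln k <= ln (ln (k ^ k))]. *)
Let k := N.+4.
(** A node is the word of child indices leading to it from the root, so ancestry is the prefix
    relation and leaves are the words of length [k]. *)
Let X : finType := k.-bseq 'I_k.
Let leaf : finType := k.-tuple 'I_k.
Implicit Types (w : leaf) (v : X) (u : seq 'I_k) (S : {set X}).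

Let node u : X := insub_bseq k u.

Lemma val_node u : (size u <= k)%N -> node u = u :> seq _.
Proof. by move=> su; rewrite /node /insub_bseq insubdK. Qed.

Definition ancestors w : {set X} := [set v : X | prefix v w].

Definition path_count w S : nat := #|S :&: ancestors w|.

Definition path_xos S : R := (\max_(w : leaf) path_count w S)%:R.

Lemma prefix_size_eq (u1 u2 u : seq 'I_k) :
  prefix u1 u -> prefix u2 u -> size u1 = size u2 -> u1 = u2.
Proof. by rewrite !prefixE => /eqP u1E /eqP u2E su; rewrite -u1E su. Qed.

(** One prefix for each length from 0 to [k]: the root and the leaf itself both count. *)
Lemma card_ancestors w : #|ancestors w| = k.+1.
Proof.
have st (i : 'I_k.+1) : size (take i w) = i.
  by rewrite size_take_min size_tuple; apply/minn_idPl; rewrite -ltnS.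
have vt (i : 'I_k.+1) : node (take i w) = take i w :> seq _.
  by rewrite val_node // st -ltnS.
have -> : ancestors w = [set node (take i w) | i : 'I_k.+1].
  apply/setP => v; rewrite inE; apply/idP/imsetP => [vw|[i _ ->]]; last first.
    by rewrite vt prefix_take.
  exists (Ordinal (size_bseq v : (size v < k.+1)%N)) => //.
  apply/val_inj; rewrite [RHS]vt.
  by apply/esym/eqP; rewrite -prefixE.
rewrite card_imset ?card_ord // => i j /(congr1 (fun v : X => size v)).
by rewrite !vt !st => /val_inj.
Qed.

Lemma path_count_le w S : (path_count w S <= k.+1)%N.
Proof. by rewrite -(card_ancestors w) subset_leq_card // subsetIr. Qed.

Lemma path_xos_le S : path_xos S <= k.+1%:R.
Proof. by rewrite ler_nat; apply/bigmax_leqP => w _; exact: path_count_le. Qed.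

Lemma path_xos_ancestors w : path_xos (ancestors w) = k.+1%:R.
Proof.
apply/eqP; rewrite eq_le path_xos_le /= ler_nat; apply: (bigop.bigmax_sup w) => //.
by rewrite /path_count setIid card_ancestors.
Qed.

Lemma path_xos1 v : path_xos [set v] <= 1.
Proof.
rewrite (_ : 1 = 1%:R) // ler_nat; apply/bigmax_leqP => w _.
by rewrite -(cards1 v) subset_leq_card // subsetIl.
Qed.

Lemma sum_prefix w S : \sum_(v in S) (prefix v w)%:R = (path_count w S)%:R :> R.
Proof.
rewrite -natr_sum -big_mkcondr /= sum1_card /path_count.
by congr (_%:R); apply: eq_card => v; rewrite !inE.
Qed.

Lemma path_xos_with : monotone_xos_with path_xos (k ^ k).
Proof.
have cW : #|{: leaf}| = (k ^ k)%N by rewrite card_tuple card_ord.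
rewrite -cW; exists (fun (i : 'I_#|{: leaf}|) v => (prefix v (enum_val i : leaf))%:R); split => // S.
split=> [i|]; first by rewrite sum_prefix ler_nat; exact: (bigop.leq_bigmax (enum_val i : leaf)).
have [|w wE] := @bigop.eq_bigmax leaf (fun w => path_count w S); first by rewrite cW expn_gt0.
by exists (enum_rank w); rewrite sum_prefix enum_rankK /path_xos wE.
Qed.

Lemma sum_le1_tight (b : X -> R) S v : (forall j, b j <= 1) ->
  \sum_(j in S) b j = #|S|%:R -> v \in S -> b v = 1.
Proof.
move=> b1 sb vS; apply/eqP; rewrite eq_le b1 /=.
have : \sum_(j in S :\ v) b j <= \sum_(j in S :\ v) 1 by exact: ler_sum.
move: sb; rewrite (big_setD1 v) //= (cardsD1 v) vS sumr_const natrD mulr1n.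
by lra.
Qed.

(* An additive function attaining the maximum on the ancestors of two leaves is
   1 on all of them, hence exceeds the maximum on their union. *)
Lemma path_xos_width : monotone_xos_of_width path_xos (k ^ k).
Proof.
split=> [|W' [b [b0 bf]]]; first exact: path_xos_with.
have b1 i v : b i v <= 1.
  apply: le_trans (path_xos1 v); have [/(_ i)+ _] := bf [set v].
  by rewrite big_set1.
have /boolp.choice[g gP] : forall w, exists i,
    path_xos (ancestors w) = \sum_(v in ancestors w) b i v.
  by move=> w; have [_] := bf (ancestors w).
have tight w v : v \in ancestors w -> b (g w) v = 1.
  move=> vw; apply: sum_le1_tight vw => //.
  by rewrite -gP path_xos_ancestors card_ancestors.
(* Distinct leaves need distinct additive functions, and there are [k ^ k] leaves. *)
suff ginj : injective g.
  by have := leq_card g ginj; rewrite card_tuple !card_ord.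
move=> w w' gww'; apply/eqP; apply: contraT => nww'.
pose v := node w'.
have vE : v = w' :> seq _ by rewrite val_node // size_tuple.
have vw : v \notin ancestors w.
  rewrite inE vE; apply: contraNN nww' => w'w.
  by apply/eqP/val_inj/esym/(prefix_size_eq w'w (prefix_refl _)); rewrite !size_tuple.
have := path_xos_le (v |: ancestors w); have [/(_ (g w))+ _] := bf (v |: ancestors w).
rewrite big_setU1 //= -gP path_xos_ancestors gww' tight ?inE ?vE ?prefix_refl //.
by move=> h1 h2; have := le_trans h1 h2; rewrite gerDr ler10.
Qed.

(** * The path constraint and its non-adaptive value *)

Definition parent v : seq 'I_k := take (size v).-1 v.

(** The condition [0 < size v] bars the root, which [parent] would send to itself. *)
Definition path_constraint : classical_sets.set (seq X) :=
  fun s => uniq s /\ exists w, forall v, v \in s -> (0 < size v)%N /\ prefix (parent v) w.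

Lemma path_probing : probing_constraint path_constraint.
Proof. by move=> s []. Qed.

Lemma path_prefix_closed : prefix_closed path_constraint.
Proof.
move=> s t st [ut [w tw]]; split; first exact: prefix_uniq ut.
by exists w => v vs; apply: tw; case/prefixP: st => t' ->; rewrite mem_cat vs.
Qed.

Let p : X -> R := fun=> k%:R^-1.

Lemma p_path01 : activation_probabilities p.
Proof. by move=> v; rewrite invr_ge0 ler0n invf_le1 ?ler1n ?ltr0n. Qed.

(* A root-leaf path leaves the path to [w] only once. *)
Lemma path_count_off w w' (s : seq X) :
  (forall v, v \in s -> (0 < size v)%N /\ prefix (parent v) w) ->
  (path_count w' [set:: s] <= count (fun v : X => prefix v w) s + 1)%N.
Proof.
move=> sw; rewrite /path_count -(cardsID (ancestors w)); apply: leq_add.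
  rewrite -size_filter; apply: leq_trans (card_size [seq v : X <- s | prefix v w]).
  apply: subset_leq_card; apply/fintype.subsetP => v.
  by rewrite !inE mem_filter => /andP[/andP[-> _] ->].
apply/card_le1_eqP => v1 v2; rewrite !inE => /andP[n1 /andP[s1 w1]] /andP[n2 /andP[s2 w2]].
(* If [x] were strictly shorter than [y] on the path to [w'], it would be a prefix of [parent y],
   hence of [w]. Two off-path nodes thus have equal length and coincide. *)
have lt (x y : X) : (x \in s) -> y \in s -> prefix x w' -> prefix y w' ->
    ~~ prefix x w -> (size y <= size x)%N.
  move=> xs ys xw' yw' nx; rewrite leqNgt; apply: contraNN nx => xy.
  have [y0 yw] := sw _ ys; apply: prefix_trans yw.
  have -> : (x : seq _) = take (size x) (parent y).
    rewrite /parent take_takel; last by rewrite -ltnS prednK.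
    move: xw' yw'; rewrite !prefixE => /eqP xE /eqP yE.
    by rewrite -[LHS]xE -[in RHS]yE take_takel // ltnW.
  exact: prefix_take.
apply/val_inj/(prefix_size_eq w2 w1)/eqP.
by rewrite eqn_leq !lt.
Qed.

Lemma nonadaptive_path_le s : path_constraint s -> nonadaptive_value p path_xos s <= 2.
Proof.
move=> [us [w sw]]; rewrite nonadaptive_chain //.
pose b v : R := (prefix v w)%:R.
apply: (@le_trans _ _ (tree_exp p (chain s) (fun _ a => \sum_(v <- a) b v + 1))).
  apply: le_tree_exp; first exact: p_path01.
  move=> o oI; have os := outcomes_subseq oI; rewrite (chain_path (outcomes_path oI)) in os.
  have -> : \sum_(v <- o.2) b v = (count (fun v : X => prefix v w) o.2)%:R.
    by rewrite -natr_sum -sum1_count [in RHS]big_mkcond.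
  rewrite natr1 -addn1 ler_nat; apply/bigmax_leqP => w' _; apply: path_count_off.
  by move=> v vo; apply: sw; exact: mem_subseq os _ vo.
rewrite tree_expD tree_exp_cst tree_exp_active_sum.
rewrite (@eq_tree_exp _ _ _ _ _ (fun _ _ => \sum_(v <- s) p v * b v)); last first.
  by move=> o /outcomes_path /chain_path ->.
rewrite tree_exp_cst -mulr_sumr -natr_sum.
suff : (\sum_(v <- s) prefix v w <= k)%N.
  rewrite -(ler_nat R) => H.
  have : k%:R^-1 * (\sum_(v <- s) prefix v w)%:R <= k%:R^-1 * k%:R :> R.
    by apply: ler_wpM2l => //; rewrite invr_ge0.
  by rewrite mulVf ?pnatr_eq0 //; lra.
rewrite -big_mkcond sum1_count -size_filter /=.
have /card_uniqP <- : uniq [seq v : X <- s | prefix v w] by exact: filter_uniq.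
(* Without the root only [k] nodes of the path can be probed, so their mean is at most 1; the node
   off the path adds the other 1. *)
have rootD : #|ancestors w :\ node [::]| = k.
  have := cardsD1 (node [::]) (ancestors w).
  by rewrite card_ancestors inE val_node // prefix0s add1n => -[].
apply: leq_trans (eq_leq rootD).
apply: subset_leq_card; apply/fintype.subsetP => v; rewrite mem_filter !inE => /andP[-> /sw[v0 _]].
by rewrite andbT; apply: contraTneq v0 => ->; rewrite val_node.
Qed.

(** Children of [u] are probed until one is active, and the walk descends there; if none is, it
    descends to child [ord0] all the same, so every level is visited. *)
Definition level (c : 'I_k -> dtree X) u (l : seq 'I_k) : dtree X :=
  foldr (fun i t => Probe (node (rcons u i)) (c i) t) (c ord0) l.

Fixpoint climb d u : dtree X :=
  if d is d'.+1 then level (fun i => climb d' (rcons u i)) u (enum 'I_k) else Stop.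

Definition good_outcome u (o : seq X * seq X) : Prop :=
  exists w, [/\ prefix u w,
    forall v, v \in o.1 -> (size u < size v)%N /\ prefix (parent v) w,
    forall v, v \in o.2 -> prefix v w & uniq o.1].

(** The second conclusion strengthens the induction: probes are either children listed in [l] or
    strictly deeper nodes, so a child outside [l] is not probed twice. *)
Lemma level_outcome c u l o : (size u < k)%N -> uniq l ->
  (forall i o', o' \in outcomes (c i) -> good_outcome (rcons u i) o') ->
  o \in outcomes (level c u l) ->
  good_outcome u o /\
  forall v, v \in o.1 -> (v \in [seq node (rcons u i) | i <- l]) || ((size u).+1 < size v)%N.
Proof.
move=> uk + cgood; elim: l o => [|i l IHl] o /=.
  move=> _ /cgood [w [uw ow ao uo]]; split.
    exists w; split=> //; first exact: prefix_trans (prefix_rcons _ _) uw.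
    by move=> v /ow; rewrite size_rcons => -[/ltnW].
  by move=> v /ow; rewrite size_rcons => -[].
have nE j : node (rcons u j) = rcons u j :> seq _ by rewrite val_node // size_rcons.
have pE j : parent (node (rcons u j)) = u.
  by rewrite /parent nE size_rcons /= -cats1 take_size_cat.
move=> /andP[il ul]; rewrite mem_cat => /orP[] /mapP[o' o'I -> /=].
- have [w [uw ow ao uo]] := cgood _ _ o'I.
  have uw' := prefix_trans (prefix_rcons u i) uw; split; last first.
    move=> v; rewrite !inE => /orP[->//|/ow]; rewrite size_rcons => -[-> _].
    by rewrite orbT.
  exists w; split=> //=.
  + move=> v; rewrite inE => /orP[/eqP->|/ow]; first by rewrite pE nE size_rcons.
    by rewrite size_rcons => -[/ltnW].
  + by move=> v; rewrite inE => /orP[/eqP->|/ao//]; rewrite nE.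
  + rewrite uo andbT; apply/negP => /ow; rewrite nE ltnn; by case.
- have [[w [uw ow ao uo]] cl] := IHl _ ul o'I; split; last first.
    by move=> v; rewrite !inE => /orP[->//|/cl/orP[->|->]]; rewrite ?orbT.
  exists w; split=> //=.
  + by move=> v; rewrite inE => /orP[/eqP->|/ow//]; rewrite pE nE size_rcons.
  + rewrite uo andbT; apply/negP => /cl; rewrite nE size_rcons ltnn orbF.
    case/mapP => j jl /(congr1 (fun v : X => v : seq _)); rewrite !nE => /rcons_inj[ij].
    by rewrite ij jl in il.
Qed.

Lemma climb_outcome d u o : (size u + d = k)%N ->
  o \in outcomes (climb d u) -> good_outcome u o.
Proof.
elim: d u o => [|d IHd] u o sud.
  rewrite inE => /eqP->; rewrite addn0 in sud.
  by exists (tcast sud (in_tuple u)); split=> //; rewrite val_tcast prefix_refl.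
move=> oI; have uk : (size u < k)%N by apply: leq_trans (eq_leq sud); rewrite addnS ltnS leq_addr.
have [] // := level_outcome uk (enum_uniq 'I_k) _ oI.
by move=> i o' /IHd; apply; rewrite size_rcons addSnnS.
Qed.

Lemma climb_strategy : adaptive_strategy path_constraint (climb k [::]).
Proof.
move=> s /root_leaf_outcome[o oI <-].
have [w [_ ow _ uo]] := climb_outcome (erefl : size [::] + k = k)%N oI.
by split=> //; split=> //; exists w.
Qed.

(** The continuation is worth at least [B] in every case, and one more active node is found unless
    all [size l] children are inactive. *)
Lemma level_size_ge c u l (B : R) :
  (forall i, B <= tree_exp p (c i) (fun _ a => (size a)%:R)) ->
  B + 1 - (1 - k%:R^-1) ^+ size l <=
    tree_exp p (level c u l) (fun _ a => (size a)%:R).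
Proof.
move=> cB; elim: l => [|i l IHl] /=; first by rewrite expr0 addrK.
rewrite (@eq_tree_exp _ _ _ (c i) _ (fun _ a => 1 + (size a)%:R)); last first.
  by move=> o _; rewrite /= -natr1 addrC.
rewrite tree_expD tree_exp_cst exprS.
set q := (1 - k%:R^-1) ^+ _ in IHl *; have /andP[] := p_path01 (node u).
rewrite /p => p0 p1; set T := tree_exp _ _ _ in IHl *.
have H1 : k%:R^-1 * B <= k%:R^-1 * tree_exp p (c i) (fun _ a => (size a)%:R).
  exact: ler_wpM2l.
have : (1 - k%:R^-1) * (B + 1 - q) <= (1 - k%:R^-1) * T.
  by apply: ler_wpM2l; rewrite ?subr_ge0.
by move: H1; rewrite /p; lra.
Qed.

(** The power is at most [expR (-1)], and [expR 1 >= 2]. *)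
Lemma pow_one_sub_inv_le : (1 - k%:R^-1) ^+ k <= 2^-1 :> R.
Proof.
have k0 : k%:R != 0 :> R by rewrite pnatr_eq0.
apply: (@le_trans _ _ (expR (- k%:R^-1) ^+ k)).
  apply: lerXn2r; rewrite ?nnegrE ?expR_ge0 ?expR_ge1Dx //.
  by have /andP[] := p_path01 (node [::]); rewrite subr_ge0.
rewrite -expRM_natr mulNr mulVf // expRN lef_pV2 ?posrE ?expR_gt0 //.
by apply: le_trans (expR_ge1Dx 1); lra.
Qed.

Lemma climb_size_ge d u :
  d%:R / 2 <= tree_exp p (climb d u) (fun _ a => (size a)%:R).
Proof.
elim: d u => [|d IHd] u; first by rewrite mul0r.
apply: le_trans (level_size_ge u (enum 'I_k) (fun i => IHd (rcons u i))).
have := pow_one_sub_inv_le; rewrite size_enum_ord -[d.+1%:R]natr1; lra.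
Qed.

(** All active nodes found by [climb] lie on one root-leaf path, so [path_xos] is at least their
    number. *)
Lemma adaptive_path_ge : k%:R / 2 <= best_adaptive p path_xos path_constraint.
Proof.
apply: le_trans (adaptive_le_best p_path01 _ climb_strategy); last first.
  exact: xos_mono path_xos_with.
rewrite /adaptive_value expect_observed; last by move=> s /climb_strategy[].
apply: le_trans (climb_size_ge k [::]) _; apply: le_tree_exp; first exact: p_path01.
move=> o oI; have [w [_ _ ao uo]] := climb_outcome (erefl : size [::] + k = k)%N oI.
rewrite ler_nat; apply: (bigop.bigmax_sup w) => //.
have /card_uniqP <- := subseq_uniq (outcomes_subseq oI) uo.
by apply: subset_leq_card; apply/fintype.subsetP => v vo; rewrite !inE vo ao.
Qed.

Lemma nonadaptive_path_best : 0 <= best_nonadaptive p path_xos path_constraint <= 2.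
Proof.
have F0 : path_constraint [::] by split=> //; exists [tuple ord0 | i < k].
apply/andP; split.
  apply: le_trans (nonadaptive_le_best p_path01 _ F0); last exact: xos_mono path_xos_with.
  rewrite -[leLHS](expect_active_cst p); apply: (expect_active_le p_path01) => A.
  exact: ler0n.
apply: ge_sup; first by exists (nonadaptive_value p path_xos [::]); exists [::].
by move=> _ [s Fs ->]; exact: nonadaptive_path_le.
Qed.

(** The numerator is [k * ln k], and the denominator is at least [ln k] because [k * ln k >= k]. *)
Lemma ln_ratio_le : ln (k ^ k)%:R / ln (ln (k ^ k)%:R) <= k%:R :> R.
Proof.
have k0 : 0 < k%:R :> R by rewrite ltr0n.
have lnk : 1 <= ln k%:R :> R.
  apply: (@le_trans _ _ (ln (2 ^+ 2))).
    by rewrite lnXn // -[leRHS]mulr_natl; have := ln2_ge R; lra.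
  by rewrite ler_ln ?posrE ?exprn_gt0 // -natrX ler_nat.
have lnW : ln (k ^ k)%:R = k%:R * ln k%:R :> R by rewrite natrX lnXn // mulr_natl.
have lnlnW : ln k%:R <= ln (ln (k ^ k)%:R) :> R.
  by rewrite lnW ler_ln ?posrE ?mulr_gt0 //; [rewrite ler_peMr // ltW | lra].
rewrite ler_pdivrMr; last by lra.
by rewrite lnW; apply: ler_wpM2l => //; rewrite -lnW.
Qed.

Lemma path_gap_ge :
  ((4^-1 * (ln (k ^ k)%:R / ln (ln (k ^ k)%:R)))%:E <=
   adaptivity_gap p path_xos path_constraint)%E.
Proof.
rewrite /adaptivity_gap; have /andP[] := nonadaptive_path_best.
have := adaptive_path_ge; have := ln_ratio_le.
set r := ln _ / _; set AD := best_adaptive _ _ _; set NA := best_nonadaptive _ _ _.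
move=> rk kAD NA0 NA2; have k0 : 0 < k%:R :> R by rewrite ltr0n.
(* A zero non-adaptive optimum makes the gap infinite; otherwise [k / 2] against 2 leaves
   [k / 4]. *)
have [->|NAn] := eqVneq NA 0.
  by rewrite inve0 gt0_muley ?leey // lte_fin; lra.
have NAp : 0 < NA by rewrite lt_neqAle eq_sym NAn.
rewrite inver (negbTE NAn) lee_pdivlMr // lee_fin.
have : 4^-1 * r * NA <= 4^-1 * k%:R * NA by apply: ler_wpM2r => //; lra.
have : 4^-1 * k%:R * NA <= 4^-1 * k%:R * 2 by apply: ler_wpM2l => //; lra.
by lra.
Qed.

(** The leaves make up at least half of the tree, so the width is linear in the number of
    elements. *)
Lemma card_nodes_le : (#|X| <= 2 * k ^ k)%N.
Proof.
have geom m : (\sum_(i < m.+1) k ^ i <= 2 * k ^ m)%N.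
  elim: m => [|m IHm]; first by rewrite big_ord_recl big_ord0 expn0.
  rewrite big_ord_recr /= mul2n -addnn; apply: leq_add => //.
  by apply: leq_trans IHm _; rewrite expnS leq_mul2r orbC.
by rewrite card_bseq card_ord geom.
Qed.

Lemma card_nodes_ge : (k ^ k <= #|X|)%N.
Proof. by rewrite card_bseq card_ord big_ord_recr /= leq_addl. Qed.

Lemma exists_large_gap :
  exists (X : finType) (f : {set X} -> R) (W : nat) (p : X -> R)
         (F : classical_sets.set (seq X)),
    [/\ monotone_xos_of_width f W,
        activation_probabilities p,
        probing_constraint F &
        prefix_closed F] /\
    [/\ (N <= #|X|)%N,
        2^-1 * #|X|%:R <= W%:R :> R,
        W%:R <= 1 * #|X|%:R :> R &
        ((4^-1 * (ln W%:R / ln (ln W%:R)))%:E <= adaptivity_gap p f F)%E].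
Proof.
exists X, path_xos, (k ^ k)%N, p, path_constraint; split; split.
- exact: path_xos_width.
- exact: p_path01.
- exact: path_probing.
- exact: path_prefix_closed.
- apply: leq_trans card_nodes_ge; apply: leq_trans (ltnW (ltn_expl k _)) => //.
  by rewrite /k -addn4 leq_addr.
- have := card_nodes_le; rewrite -(ler_nat R) natrM; lra.
- by rewrite mul1r ler_nat card_nodes_ge.
- exact: path_gap_ge.
Qed.

End LowerBound.

Theorem theorem3 (R : realType) :
  (exists C : R, 0 < C /\
     forall (X : finType) (f : {set X} -> R) (W : nat) (p : X -> R)
            (F : set (seq X)),
       monotone_xos_of_width f W ->
       activation_probabilities p ->
       probing_constraint F ->
       prefix_closed F ->
       (adaptivity_gap p f F <= (C * ln (maxn W 2)%:R)%:E)%E)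
  /\
  (exists c c1 c2 : R, [/\ 0 < c, 0 < c1 & 0 < c2] /\
     forall N : nat,
       exists (X : finType) (f : {set X} -> R) (W : nat) (p : X -> R)
              (F : set (seq X)),
         [/\ monotone_xos_of_width f W,
             activation_probabilities p,
             probing_constraint F &
             prefix_closed F] /\
         [/\ (N <= #|X|)%N,
             c1 * #|X|%:R <= W%:R,
             W%:R <= c2 * #|X|%:R &
             ((c * (ln W%:R / ln (ln W%:R)))%:E <= adaptivity_gap p f F)%E]).
Proof.
split.
  exists 12; split=> // X f W p F [xosf _] p01 uF _.
  exact: adaptivity_gap_le.
exists 4^-1, 2^-1, 1; split; first by split; rewrite ?invr_gt0.
exact: exists_large_gap.
Qed.
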